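(* Let $(\mathcal{A},m)$ be a multiarrangement in $V=\mathbb{K}^\ell$ and let $H\in\mathcal{A}$. Then the restriction of forms along the inclusion $i_H\colon H\to V$ maps $\Omega^1(\mathcal{A},m')$ into $\Omega^1(\mathcal{A}^H,m^* )$, and the sequence $$0\longrightarrow \Omega^1(\mathcal{A},m)\xrightarrow{\ \cdot\alpha_H\ }\Omega^1(\mathcal{A},m')\xrightarrow{\ i_H^*\ }\Omega^1(\mathcal{A}^H,m^* )$$ is exact, where $m'=m-\delta_H$ and $m^*$ is the Euler multiplicity on $\mathcal{A}^H$.
   Context: Let $\mathbb{K}$ be a field, $V=\mathbb{K}^\ell$, $S=\mathbb{K}[x_1,\dots,x_\ell]$ its coordinate ring, $\mathrm{Der}\,S=\bigoplus_i S\,\partial_{x_i}$, $\Omega^1_V=\bigoplus_i S\,dx_i$, $\Omega^p_V=\bigwedge^p\Omega^1_V$. An arrangement $\mathcal{A}$ is a finite set of linear hyperplanes in $V$; for each $H\in\mathcal{A}$ fix a linear form $\alpha_H\in V^*$ with $\ker\alpha_H=H$. A multiarrangement $(\mathcal{A},m)$ is an arrangement with a map $m\colon\mathcal{A}\to\mathbb{Z}_{>0}$; a multiplicity $0$ is also allowed and means that the hyperplane is deleted. Put $Q(\mathcal{A},m)=\prod_{H\in\mathcal{A}}\alpha_H^{m(H)}$ and $$D(\mathcal{A},m)=\{\theta\in\mathrm{Der}\,S\mid\theta(\alpha_H)\in S\alpha_H^{m(H)}\ \forall H\in\mathcal{A}\},$$ $$\Omega^1(\mathcal{A},m)=\Big\{\omega\in\tfrac{1}{Q(\mathcal{A},m)}\Omega^1_V\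 \Big|\ \omega\wedge d\alpha_H\in\tfrac{\alpha_H^{m(H)}}{Q(\mathcal{A},m)}\Omega^2_V\ \forall H\in\mathcal{A}\Big\}.$$ An element $\sum_i f_i\partial_{x_i}$ is homogeneous of degree $d$ if all $f_i$ are homogeneous of degree $d$. Fix $H\in\mathcal{A}$ with $m(H)\ge1$. Let $\delta_H\colon\mathcal{A}\to\{0,1\}$ take value $1$ exactly at $H$, and $m'=m-\delta_H$. The restriction is $\mathcal{A}^H=\{L\cap H\mid L\in\mathcal{A}\setminus\{H\}\}$, an arrangement in $H$, whose coordinate ring is $\overline{S}=S/(\alpha_H)$. Euler multiplicity $m^*\colon\mathcal{A}^H\to\mathbb{Z}_{>0}$: for $X\in\mathcal{A}^H$ let $\mathcal{A}_X=\{K\in\mathcal{A}\mid K\supseteq X\}$ and $m_X=m|_{\mathcal{A}_X}$. The essentialization $(\mathcal{A}_X^e,m_X)$ in the $2$-dimensional space $V/X$ is free, and its module of logarithmic derivations has a homogeneous basis $\theta_X,\varphi_X$ with $\alpha_H\nmid\theta_X$ and $\alpha_H\mid\varphi_X$ (divisibility in the module of derivations). Set $m^*(X)=\deg\theta_X$. The map $i_H^*$: choosing coordinates with $x_1=\alpha_H$, any $\omega\in\Omega^1(\mathcal{A},m')$ can be written $\omega=g\,dx_1+\omega_0$ where $\omega_0$ involves only $dx_2,\dots,dx_\ell$ and has coefficients without poles along $H$; then $i_H^*(\omega)$ is $\omega_0$ with its coefficients reduced modulo $x_1$ (a rational $1$-form on $H$). *)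

(* Defs.v *)
From Stdlib Require Import ClassicalEpsilon.
From mathcomp Require Import all_boot all_order all_algebra.
From mathcomp Require Import finmap.
From mathcomp Require Import mpoly.

Set Implicit Arguments.
Unset Strict Implicit.
Unset Printing Implicit Defensive.

Import GRing.Theory.
Local Open Scope fset_scope.
Local Open Scope ring_scope.

Notation "p %:F" := (tofrac p) : ring_scope.

(* V = K^l is the space 'rV[K]_l of row vectors.                              *)
Notation linform K l := 'Hom('rV[K]_l, K^o).

(* A function on hyperplanes is total on subspaces; only its values on the
   arrangement matter.                                                        *)
Notation multiplicity K l := ({vspace 'rV[K]_l} -> nat).
Notation formchoice K l := ({vspace 'rV[K]_l} -> linform K l).

(* \sum_i f_i dx_i with f_i in Frac S, as the row vector of the f_i.          *)
Notation ratform K l := 'rV[{fraction {mpoly K[l]}}]_l.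

(* \sum_(i < j) f_ij dx_i /\ dx_j, as the alternating matrix of the f_ij.     *)
Notation ratform2 K l := 'M[{fraction {mpoly K[l]}}]_l.

(* \sum_i f_i d/dx_i, as the row vector of the f_i.                           *)
Notation derivation K l := 'rV[{mpoly K[l]}]_l.

Definition is_arrangement (K : fieldType) (l : nat)
    (A : {fset {vspace 'rV[K]_l}}) : Prop :=
  forall H, H \in A -> (\dim H).+1 = l.

Definition defining_forms (K : fieldType) (l : nat)
    (A : {fset {vspace 'rV[K]_l}}) (alpha : formchoice K l) : Prop :=
  forall H, H \in A -> lker (alpha H) = H.

Definition poly_of_form (K : fieldType) (l : nat) (a : linform K l) :
    {mpoly K[l]} :=
  \sum_(i < l) (a (delta_mx 0 i) : K) *: 'X_i.

Section Modules.
Variables (K : fieldType) (l : nat).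
Local Notation S := {mpoly K[l]}.

Definition der_apply (theta : derivation K l) (p : S) : S :=
  \sum_(i < l) theta 0 i * p^`M(i).

Definition der_homogeneous (d : nat) (theta : derivation K l) : Prop :=
  forall i, theta 0 i \is d.-homog.

Definition der_divides (p : S) (theta : derivation K l) : Prop :=
  exists psi : derivation K l, theta = p *: psi.

Definition is_basis2 (M : derivation K l -> Prop) (theta phi : derivation K l) :
    Prop :=
  [/\ M theta, M phi &
    forall psi, M psi -> exists! c : S * S, psi = c.1 *: theta + c.2 *: phi].

Definition ext_d (p : S) : ratform K l := \row_(i < l) (p^`M(i))%:F.

Definition wedge (omega eta : ratform K l) : ratform2 K l :=
  \matrix_(i < l, j < l) (omega 0 i * eta 0 j - omega 0 j * eta 0 i).

Variables (A : {fset {vspace 'rV[K]_l}}) (alpha : formchoice K l)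
  (m : multiplicity K l).

Definition defpoly : S := \prod_(H <- A) poly_of_form (alpha H) ^+ m H.

Definition log_der (theta : derivation K l) : Prop :=
  forall H, H \in A ->
    exists q : S, der_apply theta (poly_of_form (alpha H))
                  = q * poly_of_form (alpha H) ^+ m H.

Definition log_form (omega : ratform K l) : Prop :=
  (exists eta : 'rV[S]_l,
     omega = (defpoly%:F)^-1 *: map_mx (@tofrac _) eta)
  /\ (forall H, H \in A ->
     exists tau : 'M[S]_l,
       wedge omega (ext_d (poly_of_form (alpha H)))
       = ((poly_of_form (alpha H) ^+ m H)%:F / defpoly%:F)
         *: map_mx (@tofrac _) tau).

End Modules.

Definition mult_sub (K : fieldType) (l : nat) (m : multiplicity K l)
    (H : {vspace 'rV[K]_l}) : multiplicity K l :=
  fun L => (m L - (L == H))%N.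

(* A^H, as a set of subspaces of V contained in H.                            *)
Definition restriction (K : fieldType) (l : nat) (A : {fset {vspace 'rV[K]_l}})
    (H : {vspace 'rV[K]_l}) : {fset {vspace 'rV[K]_l}} :=
  [fset (L :&: H)%VS | L in A `\ H].

Definition localization (K : fieldType) (l : nat) (A : {fset {vspace 'rV[K]_l}})
    (X : {vspace 'rV[K]_l}) : {fset {vspace 'rV[K]_l}} :=
  [fset L in A | (X <= L)%VS].

(* V/X is identified with K^2 through a surjection pi : V -> K^2 with kernel X;
   the hyperplanes of A_X^e are then the images under pi of those of A_X, and
   the hyperplane L of A_X^e has the multiplicity of its preimage.            *)
Definition is_euler_multiplicity (K : fieldType) (l : nat)
    (A : {fset {vspace 'rV[K]_l}}) (m : multiplicity K l)
    (H : {vspace 'rV[K]_l}) (mstar : multiplicity K l) : Prop :=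
  forall X, X \in restriction A H ->
  exists (pi : 'Hom('rV[K]_l, 'rV[K]_2)) (alphae : formchoice K 2)
         (theta phi : derivation K 2) (e : nat),
  let Ae := [fset (pi @: L)%VS | L in localization A X] in
  let me := fun L : {vspace 'rV[K]_2} => m (pi @^-1: L)%VS in
  let aH := poly_of_form (alphae (pi @: H)%VS) in
  [/\ lker pi = X /\ limg pi = fullv,
      defining_forms Ae alphae,
      is_basis2 (log_der Ae alphae me) theta phi,
      der_homogeneous (mstar X) theta /\ der_homogeneous e phi &
      ~ der_divides aH theta /\ der_divides aH phi].

(* Linear coordinates y_0, ..., y_n on V with y_0 = alpha_H, given by the basis
   of V (the rows of B) to which they are dual: x = y *m B.  The last n rows
   form a basis of H, on which y_1, ..., y_n are the coordinates.             *)
Definition adapted_basis (K : fieldType) (n : nat) (aH : linform K n.+1)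
    (B : 'M[K]_n.+1) : Prop :=
  B \in unitmx /\ forall j, aH (row j B) = (j == ord0)%:R.

Section RestrictionToH.
Variables (K : fieldType) (n : nat) (B : 'M[K]_n.+1).

(* i_H : H -> V, with H identified with K^n by y_1, ..., y_n.                 *)
Definition incl : 'Hom('rV[K]_n, 'rV[K]_n.+1) :=
  linfun (mulmxr (row' ord0 B)).

(* S -> S / (alpha_H) = K[y_1, ..., y_n].                                     *)
Definition reduce_poly (p : {mpoly K[n.+1]}) : {mpoly K[n]} :=
  p \mPo [tuple \sum_(j < n) B (lift ord0 j) i *: 'X_j | i < n.+1].

Definition has_reduction (f : {fraction {mpoly K[n.+1]}})
    (h : {fraction {mpoly K[n]}}) : Prop :=
  exists p q : {mpoly K[n.+1]},
    [/\ reduce_poly q != 0, f = p%:F / q%:F &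
        h = (reduce_poly p)%:F / (reduce_poly q)%:F].

Definition no_pole_along_H (f : {fraction {mpoly K[n.+1]}}) : Prop :=
  exists h, has_reduction f h.

(* Unspecified if f has a pole along H.                                       *)
Definition reduce_frac (f : {fraction {mpoly K[n.+1]}}) :
    {fraction {mpoly K[n]}} :=
  epsilon (inhabits 0) (has_reduction f).

(* The coefficient of dy_j in omega: dx_i = \sum_j B j i dy_j.                *)
Definition coef_dy (omega : ratform K n.+1) (j : 'I_n.+1) :
    {fraction {mpoly K[n.+1]}} :=
  \sum_(i < n.+1) omega 0 i * ((B j i)%:MP)%:F.

Definition restrict_form (omega : ratform K n.+1) : ratform K n :=
  \row_(j < n) reduce_frac (coef_dy omega (lift ord0 j)).

(* An arrangement in H (a set of subspaces of V contained in H) and its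
   multiplicity, in the coordinates y_1, ..., y_n of H.                       *)
Definition arr_in_coords (A : {fset {vspace 'rV[K]_n.+1}}) :
    {fset {vspace 'rV[K]_n}} :=
  [fset (incl @^-1: X)%VS | X in A].

Definition mult_in_coords (m : multiplicity K n.+1) : multiplicity K n :=
  fun Y => m (incl @: Y)%VS.

End RestrictionToH.

(* Main.v *)
(* Contracting a form omega with constant vectors v turns the conditions that
   define Omega^1(A, m) into: Q omega(v) is a polynomial for all v, and
   (Q / alpha_L^m(L)) omega(v) is one for all v in L.  So everything reduces to
   pole orders along linear forms, that is, to the localizations of S at the
   primes (alpha_L).

   Let X = L :&: H and let omega be in Omega^1(A, m').  For v in X, omega(v) has
   no pole along any hyperplane containing X, hence its restriction to H has no
   pole along X.  For the remaining direction in H, lift theta_X to V along a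
   section of pi : V -> V/X and pair it with omega.  The pairing has no pole
   along any hyperplane containing X, and modulo alpha_H it equals f * omega(v)
   with v spanning H/X.  Here f is homogeneous of degree mstar X on the line H/X,
   and nonzero because alpha_H does not divide theta_X; so the restriction of
   omega(v) has pole order at most mstar X along X. *)
Require Import Defs.
From mathcomp Require Import all_boot all_order all_algebra.
From mathcomp Require Import finmap.
From mathcomp Require Import mpoly.
From mathcomp Require Import ring.

Set Implicit Arguments.
Unset Strict Implicit.
Unset Printing Implicit Defensive.

Import GRing.Theory.
Local Open Scope ring_scope.

Lemma divr_mull {F : fieldType} (x y : F) : x != 0 -> x / (x * y) = y^-1.
Proof. by move=> x0; rewrite invfM mulrA divff ?mul1r. Qed.

(** * Pole orders along a prime element, in the fraction field of a domain *)

Section PoleOrder.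
Context {R : idomainType}.
Implicit Types (p q u : R) (g h : {fraction R}).

Definition divides p q := exists r, q = r * p.

Definition prime_element p :=
  [/\ p != 0, ~ divides p 1 &
      forall q u, divides p (q * u) -> divides p q \/ divides p u].

Definition integral g := exists p, g = p%:F.

(* Membership in the localization of R at the prime ideal (p). *)
Definition regular_at p g :=
  exists r u, ~ divides p u /\ g * u%:F = r%:F.

Lemma tofrac_inj : injective (@tofrac R).
Proof. by move=> p q /eqP; rewrite tofrac_eq => /eqP. Qed.

Lemma integral_tofrac p : integral p%:F.
Proof. by exists p. Qed.

Lemma integralM g h : integral g -> integral h -> integral (g * h).
Proof. by move=> [p ->] [q ->]; exists (p * q); rewrite tofracM. Qed.

Lemma integralD g h : integral g -> integral h -> integral (g + h).
Proof. by move=> [p ->] [q ->]; exists (p + q); rewrite tofracD. Qed.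

Lemma integral_sum (I : Type) (r : seq I) (P : pred I) (F : I -> {fraction R}) :
  (forall i, P i -> integral (F i)) -> integral (\sum_(i <- r | P i) F i).
Proof.
move=> F_int; apply: (big_ind integral) => //; last exact: integralD.
by exists 0; rewrite tofrac0.
Qed.

Lemma prime_element_prod p (T : Type) (r : seq T) (P : pred T) (a : T -> R)
    (N : T -> nat) :
  prime_element p -> (forall t, P t -> ~ divides p (a t)) ->
  ~ divides p (\prod_(t <- r | P t) a t ^+ N t).
Proof.
move=> [_ p1 pM] pa.
apply: (big_ind (fun q => ~ divides p q)) => // [q u pq pu /pM[]//|t Pt].
elim: (N t) => [|k IHk]; first by rewrite expr0.
by rewrite exprS => /pM[/(pa t Pt)|].
Qed.

Lemma prime_element_prod_in p (T : eqType) (r : seq T) (P : pred T)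
    (a : T -> R) (N : T -> nat) :
  prime_element p -> (forall t, t \in r -> P t -> ~ divides p (a t)) ->
  ~ divides p (\prod_(t <- r | P t) a t ^+ N t).
Proof.
move=> p_prime pa; rewrite big_seq_cond.
by apply: prime_element_prod => // t /andP[]; apply: pa.
Qed.

Lemma divides0 p : divides p 0.
Proof. by exists 0; rewrite mul0r. Qed.

Lemma regular_at_tofrac p q : prime_element p -> regular_at p q%:F.
Proof. by case=> _ p1 _; exists q, 1; rewrite tofrac1 mulr1. Qed.

Lemma regular_at_integral p g : prime_element p -> integral g -> regular_at p g.
Proof. by move=> p_prime [q ->]; apply: regular_at_tofrac. Qed.

Lemma regular_atM p g h : prime_element p ->
  regular_at p g -> regular_at p h -> regular_at p (g * h).
Proof.
case=> _ _ pM [r [u [pu gu]]] [s [v [pv hv]]]; exists (r * s), (u * v).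
split; first by move/pM => [].
by rewrite !tofracM mulrACA gu hv.
Qed.

Lemma regular_atD p g h : prime_element p ->
  regular_at p g -> regular_at p h -> regular_at p (g + h).
Proof.
case=> _ _ pM [r [u [pu gu]]] [s [v [pv hv]]]; exists (r * v + s * u), (u * v).
split; first by move/pM => [].
by rewrite tofracD !tofracM -gu -hv; ring.
Qed.

Lemma regular_at_sum p (I : Type) (r : seq I) (P : pred I)
    (F : I -> {fraction R}) : prime_element p ->
  (forall i, P i -> regular_at p (F i)) ->
  regular_at p (\sum_(i <- r | P i) F i).
Proof.
move=> p_prime F_reg.
apply: (big_ind (regular_at p)) => // [|g h]; last exact: regular_atD.
by rewrite -tofrac0; apply: regular_at_tofrac.
Qed.

Lemma regular_at_divl p u g : prime_element p -> ~ divides p u ->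
  regular_at p (u%:F * g) -> regular_at p g.
Proof.
move=> [_ _ pM] pu [r [v [pv gv]]]; exists r, (u * v).
by split; [move/pM => [] | rewrite tofracM mulrA [g * _]mulrC].
Qed.

Lemma divides_expM p u q k : prime_element p -> ~ divides p u ->
  divides (p ^+ k) (q * u) -> divides (p ^+ k) q.
Proof.
move=> [p0 _ pM] pu; elim: k q => [|k IHk] q.
  by exists q; rewrite expr0 mulr1.
case=> r; rewrite exprS mulrCA => qE.
have [[q' q'E]|//] : divides p q \/ divides p u.
  by apply: pM; exists (r * p ^+ k); rewrite qE mulrC.
have [s sE] : divides (p ^+ k) q'.
  apply: IHk; exists r; apply: (mulfI p0).
  by rewrite -qE q'E mulrA [p * _]mulrC.
by exists s; rewrite q'E sE; ring.
Qed.

(** Write h = r / u with u prime to p, and let q = h p^N v. Then q u = p^N v r, so p^N divides q and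
    can be cancelled. The spare factor v carries the remaining denominators through the induction in
    [integral_of_regular]. *)
Lemma integral_regular_at p N v h : prime_element p -> regular_at p h ->
  integral (h * (p ^+ N * v)%:F) -> integral (h * v%:F).
Proof.
move=> p_prime [r [u [pu hu]]] [q qE]; have [p0 _ _] := p_prime.
have [s sE] : divides (p ^+ N) q.
  apply: (divides_expM p_prime pu); exists (v * r); apply: tofrac_inj.
  by rewrite !tofracM -qE -hu tofracM; ring.
exists s; apply: (@mulIf _ (p ^+ N)%:F).
  by rewrite tofrac_eq0 expf_neq0.
by rewrite -tofracM -sE -qE tofracM; ring.
Qed.

(** The denominators are stripped one prime at a time. Primes may repeat up to units, as happens on
    H when different L have the same [L :&: H]. *)
Lemma integral_of_regular (T : eqType) (r : seq T) (P : pred T) (a : T -> R)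
    (N : T -> nat) h :
  (forall t, t \in r -> P t -> prime_element (a t)) ->
  (forall t, t \in r -> P t -> regular_at (a t) h) ->
  integral (h * (\prod_(t <- r | P t) a t ^+ N t)%:F) -> integral h.
Proof.
elim: r => [|t r IHr] a_prime a_reg; first by rewrite big_nil tofrac1 mulr1.
have {}IHr : integral (h * (\prod_(t <- r | P t) a t ^+ N t)%:F) -> integral h.
  by apply: IHr => s sr; [apply: a_prime | apply: a_reg]; rewrite inE sr orbT.
rewrite big_cons; case: ifP => // Pt hint; apply: IHr.
have tr : t \in t :: r by rewrite mem_head.
exact: integral_regular_at (a_prime t tr Pt) (a_reg t tr Pt) hint.
Qed.

End PoleOrder.

(** * Linear forms, linear substitutions, and primality of linear forms *)

Definition linpoly {K : fieldType} {l} (a : 'cV[K]_l) : {mpoly K[l]} :=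
  \sum_(i < l) a i 0 *: 'X_i.

(* x |-> x *m M on coordinates *)
Definition subst_of_mx {K : fieldType} {k l} (M : 'M[K]_(k, l)) :
    l.-tuple {mpoly K[k]} :=
  [tuple \sum_(j < k) M j i *: 'X_j | i < l].

Notation pullback M := (comp_mpoly (subst_of_mx M)).

Section LinearForms.
Context {K : fieldType}.

Lemma mpoly_ind l (P : {mpoly K[l]} -> Prop) :
  (forall c, P c%:MP) -> (forall i, P 'X_i) ->
  (forall p q, P p -> P q -> P (p + q)) ->
  (forall p q, P p -> P q -> P (p * q)) -> forall p, P p.
Proof.
move=> PC PX PD PM p; rewrite (mpolyE p).
have PE q k : P q -> P (q ^+ k).
  move=> Pq; elim: k => [|k IHk]; first by rewrite expr0 -mpolyC1.
  by rewrite exprS; apply: PM.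
apply: (big_ind P) => // [|u _]; first by rewrite -mpolyC0.
rewrite -mul_mpolyC mpolyXE_id; apply: (PM) => //.
by apply: (big_ind P) => // [|i _]; [rewrite -mpolyC1 | apply: PE].
Qed.

Lemma linpolyD l : {morph @linpoly K l : a b / a + b}.
Proof.
move=> a b; rewrite /linpoly -big_split; apply: eq_bigr => i _.
by rewrite mxE scalerDl.
Qed.

Lemma linpolyZ l c (a : 'cV[K]_l) : linpoly (c *: a) = c *: linpoly a.
Proof.
by rewrite /linpoly scaler_sumr; apply: eq_bigr => i _; rewrite mxE scalerA.
Qed.

Lemma linpoly_inj l (a : 'cV[K]_l) : linpoly a = 0 -> a = 0.
Proof.
move=> a0; apply/colP => i; rewrite mxE.
have := congr1 (mcoeff U_(i)) a0; rewrite mcoeff0 linear_sum /= (bigD1 i) //=.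
rewrite linearZ /= mcoeffXU eqxx mulr1 big1 ?addr0 // => j ji.
by rewrite linearZ /= mcoeffXU (negPf ji) mulr0.
Qed.

Lemma pullbackX k l (M : 'M[K]_(k, l)) i : pullback M 'X_i = linpoly (col i M).
Proof.
rewrite comp_mpolyXU (nth_map i) ?size_tuple // nth_ord_enum.
by apply: eq_bigr => j _; rewrite mxE.
Qed.

Lemma pullback_linpoly k l (M : 'M[K]_(k, l)) a :
  pullback M (linpoly a) = linpoly (M *m a).
Proof.
rewrite {1}/linpoly linear_sum /= /linpoly.
under eq_bigr => i _ do rewrite linearZ /= pullbackX /linpoly scaler_sumr.
rewrite exchange_big; apply: eq_bigr => j _ /=.
rewrite mxE scaler_suml; apply: eq_bigr => i _.
by rewrite scalerA mxE mulrC.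
Qed.

Lemma linpoly_delta l i : linpoly (delta_mx i 0 : 'cV[K]_l) = 'X_i.
Proof.
rewrite /linpoly (bigD1 i) //= mxE !eqxx scale1r big1 ?addr0 // => j ji.
by rewrite mxE (negPf ji) scale0r.
Qed.

Lemma pullback_comp j k l (N : 'M[K]_(j, k)) (M : 'M[K]_(k, l)) p :
  pullback N (pullback M p) = pullback (N *m M) p.
Proof.
elim/mpoly_ind: p => [c|i|p q pE qE|p q pE qE].
- by rewrite !comp_mpolyC.
- by rewrite -linpoly_delta !pullback_linpoly mulmxA.
- by rewrite !rmorphD /= pE qE.
- by rewrite !rmorphM /= pE qE.
Qed.

Lemma pullback1 l (p : {mpoly K[l]}) : pullback 1%:M p = p.
Proof.
elim/mpoly_ind: p => [c|i|p q pE qE|p q pE qE].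
- by rewrite !comp_mpolyC.
- by rewrite -linpoly_delta !pullback_linpoly mul1mx.
- by rewrite !rmorphD /= pE qE.
- by rewrite !rmorphM /= pE qE.
Qed.

(* 1 - a *m w projects onto the kernel of a along w. *)
Lemma divides_sub_pullback l (a : 'cV[K]_l) (w : 'rV[K]_l) p :
  divides (linpoly a) (p - pullback (1%:M - a *m w) p).
Proof.
elim/mpoly_ind: p => [c|i|p q [r rE] [s sE]|p q [r rE] [s sE]].
- by rewrite comp_mpolyC subrr; apply: divides0.
- exists ((w 0 i)%:MP); rewrite -linpoly_delta pullback_linpoly.
  rewrite mulmxBl mul1mx -mulmxA.
  have -> : w *m delta_mx i 0 = (w 0 i)%:M.
    rewrite -colE; apply/matrixP => u v; rewrite !ord1 !mxE eqxx.
    by rewrite mulr1n.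
  rewrite mul_mx_scalar -scaleNr linpolyD linpolyZ opprD addrA subrr add0r.
  by rewrite scaleNr opprK mul_mpolyC.
- exists (r + s); rewrite rmorphD /= mulrDl -rE -sE; ring.
- exists (r * q + pullback (1%:M - a *m w) p * s).
  by rewrite rmorphM /= mulrDl mulrAC -rE -mulrA -sE; ring.
Qed.

Lemma exists_dual l (a : 'cV[K]_l) : a != 0 -> exists w : 'rV[K]_l, w *m a = 1.
Proof.
case/cV0Pn=> i ai; exists ((a i 0)^-1 *: delta_mx 0 i).
rewrite -scalemxAl -rowE; apply/rowP => j.
by rewrite !ord1 !mxE eqxx mulVf.
Qed.

(** The pullback along the projection kills [linpoly a], since (1 - a w) a = 0, and changes p only
    by a multiple of [linpoly a]. So the ideal of [linpoly a] is the kernel of a ring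
    endomorphism. *)
Lemma divides_linpolyE l (a : 'cV[K]_l) (w : 'rV[K]_l) p : w *m a = 1 ->
  divides (linpoly a) p <-> pullback (1%:M - a *m w) p = 0.
Proof.
move=> wa; split=> [[r ->]|p0]; last first.
  by have := divides_sub_pullback a w p; rewrite p0 subr0.
rewrite rmorphM /= pullback_linpoly mulmxBl mul1mx -mulmxA wa.
have -> : a *m 1 = a by apply: mulmx1.
by rewrite subrr -(scale0r 0) linpolyZ scale0r mulr0.
Qed.

(** The ideal is the kernel of a ring map into a domain. *)
Lemma linpoly_prime l (a : 'cV[K]_l) : a != 0 -> prime_element (linpoly a).
Proof.
move=> a0; have [w wa] := exists_dual a0; split.
- by apply: contra_neq a0 => /linpoly_inj.
- by move/(divides_linpolyE _ wa)/eqP; rewrite rmorph1 oner_eq0.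
move=> p q /(divides_linpolyE _ wa)/eqP.
rewrite rmorphM /= mulf_eq0 => /orP[] /eqP p0; [left|right];
  exact/(divides_linpolyE _ wa).
Qed.

(** The rows of 1 - a w lie in the kernel of a, so b kills them: b = a (w b). *)
Lemma kernel_proportional l (a b : 'cV[K]_l) : a != 0 ->
  (forall v : 'rV[K]_l, v *m a = 0 -> v *m b = 0) -> exists c, b = c *: a.
Proof.
move=> a0 kab; have [w wa] := exists_dual a0; exists ((w *m b) 0 0).
have : (1%:M - a *m w) *m b = 0.
  apply/row_matrixP => i; rewrite row_mul row0; apply: kab.
  rewrite -row_mul mulmxBl mul1mx -mulmxA wa.
  by have -> : a *m 1 = a by [apply: mulmx1]; rewrite subrr row0.
move/eqP; rewrite mulmxBl mul1mx -mulmxA subr_eq0 => /eqP {1}->.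
by rewrite {1}[w *m b]mx11_scalar mul_mx_scalar.
Qed.

Lemma divides_linpoly l (a b : 'cV[K]_l) : a != 0 ->
  divides (linpoly a) (linpoly b) ->
  forall v : 'rV[K]_l, v *m a = 0 -> v *m b = 0.
Proof.
move=> a0; have [w wa] := exists_dual a0.
move/(divides_linpolyE _ wa); rewrite pullback_linpoly => /linpoly_inj.
rewrite mulmxBl mul1mx => /eqP; rewrite subr_eq0 => /eqP-> v va.
by rewrite !mulmxA va !mul0mx.
Qed.

(** The rank-one matrix b e sends x to the multiple x b of the fixed vector e, and homogeneity pulls
    out the factor (x b)^d. *)
Lemma pullback_homog k l (b : 'cV[K]_k) (e : 'rV[K]_l) d p :
  p \is d.-homog -> pullback (b *m e) p = p.@[fun i => e 0 i] *: linpoly b ^+ d.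
Proof.
move=> /dhomogP p_d; rewrite {1 2}(mpolyE p) !linear_sum /= scaler_suml.
rewrite !big_seq; apply: eq_bigr => u up.
rewrite !linearZ /= mevalX -scalerA; congr (_ *: _).
have du : mdeg u = d := p_d u up.
rewrite comp_mpolyX -du mdegE /=.
transitivity (\prod_(i < l) (e 0 i *: linpoly b) ^+ u i).
  apply: eq_bigr => i _; congr (_ ^+ _); rewrite tnth_mktuple.
  rewrite /linpoly scaler_sumr; apply: eq_bigr => j _.
  by rewrite mxE big_ord1 mulrC scalerA.
rewrite -prodrXr -scaler_prod; apply: eq_bigr => i _.
by rewrite exprZn.
Qed.

End LinearForms.

(** * Contraction with constant vectors and the logarithmic conditions *)

Definition col_of_form {K : fieldType} {l} (f : linform K l) : 'cV[K]_l :=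
  \col_i (f (delta_mx 0 i) : K).

Definition fconst {K : fieldType} {l} (c : K) : {fraction {mpoly K[l]}} :=
  (c%:MP)%:F.

Definition contract {K : fieldType} {l} (omega : ratform K l) (v : 'rV[K]_l) :
    {fraction {mpoly K[l]}} :=
  \sum_(i < l) omega 0 i * fconst (v 0 i).

Section Contraction.
Context {K : fieldType} {l : nat}.
Implicit Types (f : linform K l) (omega : ratform K l) (u v : 'rV[K]_l).

Lemma poly_of_formE f : poly_of_form f = linpoly (col_of_form f).
Proof. by apply: eq_bigr => i _; rewrite mxE. Qed.

Lemma linform_mul f v : f v = (v *m col_of_form f) 0 0 :> K.
Proof.
rewrite {1}[v]row_sum_delta linear_sum mxE; apply: eq_bigr => i _.
by rewrite linearZ mxE.
Qed.

Lemma mem_lker_form f v : (v \in lker f) = (v *m col_of_form f == 0).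
Proof.
rewrite memv_ker linform_mul; apply/eqP/eqP => [v0|->]; last by rewrite mxE.
by apply/rowP => j; rewrite ord1 v0 mxE.
Qed.

Lemma col_of_form_neq0 f : (lker f != fullv)%VS -> col_of_form f != 0.
Proof.
apply: contra_neq => f0; apply/vspaceP => v.
by rewrite mem_lker_form f0 mulmx0 eqxx memvf.
Qed.

Lemma fconstM (a b : K) :
  fconst (a * b) = fconst a * fconst b :> {fraction {mpoly K[l]}}.
Proof. by rewrite /fconst mpolyCM tofracM. Qed.

Lemma integral_fconst (c : K) : integral (fconst c : {fraction {mpoly K[l]}}).
Proof. exact: integral_tofrac. Qed.

Lemma contractDr omega u v :
  contract omega (u + v) = contract omega u + contract omega v.
Proof.
rewrite /contract -big_split; apply: eq_bigr => i _ /=.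
by rewrite mxE /fconst mpolyCD tofracD mulrDr.
Qed.

Lemma contractZr omega (c : K) v :
  contract omega (c *: v) = fconst c * contract omega v.
Proof.
rewrite /contract mulr_sumr; apply: eq_bigr => i _ /=.
by rewrite mxE fconstM mulrCA.
Qed.

Lemma contractZl (c : {fraction {mpoly K[l]}}) omega v :
  contract (c *: omega) v = c * contract omega v.
Proof.
by rewrite /contract mulr_sumr; apply: eq_bigr => i _; rewrite mxE mulrA.
Qed.

Lemma contract_delta omega i : contract omega (delta_mx 0 i) = omega 0 i.
Proof.
rewrite /contract (bigD1 i) //= mxE !eqxx /fconst mpolyC1 tofrac1 mulr1.
rewrite big1 ?addr0 // => j ji.
by rewrite mxE (negPf ji) andbF mpolyC0 tofrac0 mulr0.
Qed.

Lemma contract_sum omega k (F : 'I_k -> 'rV[K]_l) :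
  contract omega (\sum_i F i) = \sum_i contract omega (F i).
Proof.
apply: (big_morph (contract omega)); first exact: contractDr.
by rewrite -(scale0r 0) contractZr /fconst mpolyC0 tofrac0 mul0r.
Qed.

Lemma contract_mulmx omega k (u : 'rV[K]_k) (M : 'M[K]_(k, l)) :
  contract omega (u *m M) = \sum_i fconst (u 0 i) * contract omega (row i M).
Proof.
rewrite mulmx_sum_row contract_sum; apply: eq_bigr => i _.
exact: contractZr.
Qed.

Lemma ext_d_linpoly (a : 'cV[K]_l) i : ext_d (linpoly a) 0 i = fconst (a i 0).
Proof.
rewrite mxE /fconst; congr tofrac; rewrite /linpoly linear_sum /= (bigD1 i) //=.
rewrite mderivZ mderivX mnm1E eqxx -mul_mpolyC.
rewrite big1 ?addr0 => [|j ji].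
  have -> : (U_(i) - U_(i) = 0)%MM by apply/mnmP => j; rewrite !mnmE subnn.
  by rewrite mpolyX0 scale1r mulr1.
by rewrite mderivZ mderivX mnm1E (negPf ji) scale0r scaler0.
Qed.

(* omega(v) a(w) - omega(w) a(v) = omega(v) when a(v) = 0 and a(w) = 1 *)
Lemma contract_wedge omega (a : 'cV[K]_l) (v w : 'rV[K]_l) :
  v *m a = 0 -> w *m a = 1 ->
  contract omega v =
  \sum_i \sum_j wedge omega (ext_d (linpoly a)) i j * fconst (v 0 i * w 0 j).
Proof.
move=> va wa.
have fsum (u : 'rV[K]_l) : \sum_i fconst (u 0 i) * fconst (a i 0) =
    fconst ((u *m a) 0 0) :> {fraction {mpoly K[l]}}.
  rewrite mxE /fconst !raddf_sum /=; apply: eq_bigr => i _.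
  by rewrite mpolyCM tofracM.
have fv : \sum_i fconst (v 0 i) * fconst (a i 0) = 0 :> {fraction {mpoly K[l]}}.
  by rewrite fsum va mxE /fconst mpolyC0 tofrac0.
have fw : \sum_i fconst (w 0 i) * fconst (a i 0) = 1 :> {fraction {mpoly K[l]}}.
  by rewrite fsum wa mxE eqxx mulr1n /fconst mpolyC1 tofrac1.
transitivity (contract omega v * 1 - 0 * contract omega w).
  by rewrite mulr1 mul0r subr0.
rewrite -fw -[X in _ - X * _]fv /contract !big_distrlr /= -sumrB.
apply: eq_bigr => i _ /=.
rewrite -sumrB; apply: eq_bigr => j _ /=.
by rewrite mxE !ext_d_linpoly fconstM; ring.
Qed.

(** The vector on the right lies in the kernel of a, so each coefficient of the wedge is a value of
    omega on the hyperplane. This is the converse of [contract_wedge]. *)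
Lemma wedge_contract omega (a : 'cV[K]_l) i j :
  wedge omega (ext_d (linpoly a)) i j =
  contract omega (a j 0 *: delta_mx 0 i - a i 0 *: delta_mx 0 j).
Proof.
rewrite contractDr -scaleNr !contractZr !contract_delta mxE !ext_d_linpoly.
by rewrite /fconst mpolyCN tofracN; ring.
Qed.

Section LogForms.
Variables (A : {fset {vspace 'rV[K]_l}}) (alpha : formchoice K l)
  (m : multiplicity K l).
Hypotheses (alphaA : defining_forms A alpha)
  (properA : forall L, L \in A -> L != fullv).

Local Notation a L := (col_of_form (alpha L)).

Definition defpoly_but (L : {vspace 'rV[K]_l}) : {mpoly K[l]} :=
  \prod_(L' <- A | L' != L) linpoly (a L') ^+ m L'.

Lemma mem_hyperplane L v : L \in A -> (v \in L) = (v *m a L == 0).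
Proof. by move=> AL; rewrite -{1}(alphaA AL) mem_lker_form. Qed.

Lemma form_neq0 L : L \in A -> a L != 0.
Proof.
by move=> AL; apply: col_of_form_neq0; rewrite (alphaA AL); apply: properA.
Qed.

Lemma form_prime L : L \in A -> prime_element (linpoly (a L)).
Proof. by move/form_neq0/linpoly_prime. Qed.

Lemma linform_neq0 L : L \in A -> linpoly (a L) != 0.
Proof. by case/form_prime. Qed.

Lemma defpolyE : defpoly A alpha m = \prod_(L <- A) linpoly (a L) ^+ m L.
Proof. by apply: eq_bigr => L _; rewrite poly_of_formE. Qed.

Lemma defpoly_split L : L \in A ->
  defpoly A alpha m = linpoly (a L) ^+ m L * defpoly_but L.
Proof. by move=> AL; rewrite defpolyE (bigD1_seq L) ?fset_uniq. Qed.

Lemma defpoly_neq0 : defpoly A alpha m != 0.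
Proof.
rewrite defpolyE prodf_seq_neq0; apply/allP => L AL.
by rewrite expf_neq0 ?linform_neq0.
Qed.

(** The values of omega on L and the coefficients of the wedge with d alpha_L are combinations of
    each other with constant coefficients, by [contract_wedge] and [wedge_contract]. Properness of
    the members of A is stated without dimensions, so that the criterion serves both A and its
    restriction in coordinates. *)
Lemma log_formP omega : log_form A alpha m omega <->
  (forall v, integral ((defpoly A alpha m)%:F * contract omega v)) /\
  (forall L v, L \in A -> v \in L ->
     integral ((defpoly_but L)%:F * contract omega v)).
Proof.
have Q0 : (defpoly A alpha m)%:F != 0 by rewrite tofrac_eq0 defpoly_neq0.
have poleE L : L \in A ->
    (poly_of_form (alpha L) ^+ m L)%:F / (defpoly A alpha m)%:F
    = ((defpoly_but L)%:F)^-1.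
  move=> AL; have := Q0; rewrite (defpoly_split AL) poly_of_formE tofracM.
  by rewrite mulf_eq0 negb_or => /andP[q0 _]; apply: divr_mull.
have but0 L : L \in A -> (defpoly_but L)%:F != 0.
  move=> AL; have := Q0; rewrite (defpoly_split AL) tofracM.
  by rewrite mulf_eq0 negb_or => /andP[].
split=> [[[eta ->] tauP]|[Qint butint]]; split.
- move=> v; rewrite contractZl mulrA divff // mul1r.
  apply: integral_sum => i _; rewrite mxE.
  by apply: integralM; [apply: integral_tofrac|apply: integral_fconst].
- move=> L v AL vL; have [tau tauE] := tauP _ AL.
  have [w wa] := exists_dual (form_neq0 AL).
  have va : v *m a L = 0 by apply/eqP; rewrite -mem_hyperplane.
  rewrite (contract_wedge _ va wa) -poly_of_formE tauE poleE // mulr_sumr.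
  apply: integral_sum => i _; rewrite mulr_sumr; apply: integral_sum => j _.
  rewrite !mxE mulrA mulrA divff ?but0 // mul1r.
  by apply: integralM; [apply: integral_tofrac|apply: integral_fconst].
- have [eta etaE] := fin_all_exists (fun i => Qint (delta_mx 0 i)).
  exists (\row_i eta i); apply/rowP => i; rewrite !mxE -etaE contract_delta.
  by rewrite mulKf.
- move=> L AL.
  have /fin_all_exists[tau tauE] (ij : 'I_l * 'I_l) : exists p : {mpoly K[l]},
      (defpoly_but L)%:F * wedge omega (ext_d (linpoly (a L))) ij.1 ij.2 = p%:F.
    rewrite wedge_contract; apply: butint; rewrite // mem_hyperplane //.
    rewrite mulmxBl -!scalemxAl -!rowE; apply/eqP/rowP => k.
    by rewrite !ord1 !mxE mulrC subrr.
  exists (\matrix_(i, j) tau (i, j)); apply/matrixP => i j.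
  rewrite poleE // poly_of_formE [RHS]mxE [X in _ * X]mxE [X in _ * X%:F]mxE.
  by rewrite -tauE mulKf ?but0.
Qed.

End LogForms.

End Contraction.

(** * Reduction modulo alpha_H *)

Section Reduction.
Context {K : fieldType} {n : nat}.
Variables (aH : linform K n.+1) (B : 'M[K]_n.+1).
Hypothesis B_adapted : adapted_basis aH B.

Local Notation h := (col_of_form aH).
Local Notation Br := (row' ord0 B).
Local Notation C := (col' ord0 (invmx B)).
Implicit Types (f : {fraction {mpoly K[n.+1]}}) (g : {fraction {mpoly K[n]}}).

Lemma adapted_basis_form : B *m h = delta_mx ord0 0.
Proof.
have [_ BE] := B_adapted; apply/colP => j.
have := BE j; rewrite linform_mul -row_mul mxE => ->.
by rewrite mxE eqxx andbT.
Qed.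

Lemma adapted_basis_row0 : row ord0 B *m h = 1.
Proof.
rewrite -row_mul adapted_basis_form; apply/rowP => j.
by rewrite !ord1 !mxE.
Qed.

Lemma adapted_basis_row' : Br *m h = 0.
Proof.
apply/row_matrixP => i; rewrite row_mul row0.
have -> : row i Br = row (lift ord0 i) B by apply/rowP => j; rewrite !mxE.
rewrite -row_mul adapted_basis_form; apply/rowP => j.
by rewrite !mxE.
Qed.

Lemma form_invmx : h = col ord0 (invmx B).
Proof. by rewrite colE -adapted_basis_form mulKmx //; case: B_adapted. Qed.

(** Both sides are the projection of V onto H along the first row of B. The first term of the
    product [invmx B *m B] is [h *m row ord0 B], because h is the first column of [invmx B]. *)
Lemma section_mul_incl : C *m Br = 1%:M - h *m row ord0 B.
Proof.
apply/eqP; rewrite eq_sym subr_eq; apply/eqP.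
rewrite -[LHS](mulVmx (proj1 B_adapted)) form_invmx.
apply/matrixP => i j; rewrite [LHS]mxE [RHS]mxE big_ord_recl [RHS]addrC.
congr (_ + _); first by rewrite !mxE big_ord1 !mxE.
by rewrite mxE; apply: eq_bigr => k _; rewrite !mxE.
Qed.

Lemma incl_mul_section : Br *m C = 1%:M.
Proof.
apply/matrixP => i j.
have := congr1 (fun M : 'M[K]_n.+1 => M (lift ord0 i) (lift ord0 j))
               (mulmxV (proj1 B_adapted)).
rewrite !mxE (inj_eq (@lift_inj _ _)) => <-.
by apply: eq_bigr => k _; rewrite !mxE.
Qed.

Lemma reduce_polyE p : reduce_poly B p = pullback Br p.
Proof.
rewrite /reduce_poly; congr comp_mpoly; apply: eq_mktuple => i.
by apply: eq_bigr => j _; rewrite mxE.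
Qed.

(** The projection onto H factors through its coordinates as [C *m Br], and the pullback along C is
    injective because [Br *m C] is the identity. *)
Lemma divides_reduce p : divides (linpoly h) p <-> reduce_poly B p = 0.
Proof.
rewrite reduce_polyE (divides_linpolyE _ adapted_basis_row0).
rewrite -section_mul_incl -pullback_comp.
split=> [p0|->]; last by rewrite rmorph0.
by rewrite -[LHS]pullback1 -incl_mul_section -pullback_comp p0 rmorph0.
Qed.

Lemma reduce_poly_form : reduce_poly B (linpoly h) = 0.
Proof. by apply/divides_reduce; exists 1; rewrite mul1r. Qed.

(** Cross-multiplied identities survive the ring map [reduce_poly]. Uniqueness pins down the value
    that [reduce_frac] picks, and it identifies the reduction of a product known to be a
    polynomial. *)
Lemma has_reduction_uniq f g1 g2 :
  has_reduction B f g1 -> has_reduction B f g2 -> g1 = g2.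
Proof.
case=> p1 [q1 [q1n0 -> ->]] [p2 [q2 [q2n0 fE ->]]].
have neq0 q : reduce_poly B q != 0 -> q%:F != 0.
  by rewrite tofrac_eq0; apply: contra_neq => ->; rewrite reduce_polyE rmorph0.
move/eqP: fE; rewrite eqr_div ?neq0 // -!tofracM tofrac_eq => /eqP pqE.
apply/eqP; rewrite eqr_div ?tofrac_eq0 // -!tofracM tofrac_eq.
by move: pqE; rewrite !reduce_polyE -!rmorphM /= => ->.
Qed.

Lemma reduce_frac_has f g : has_reduction B f g -> reduce_frac B f = g.
Proof.
move=> fg; apply: has_reduction_uniq (fg); rewrite /reduce_frac.
by apply: (ClassicalEpsilon.epsilon_spec (inhabits 0)); exists g.
Qed.

Lemma has_reduction_tofrac p : has_reduction B p%:F (reduce_poly B p)%:F.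
Proof.
exists p, 1; rewrite reduce_polyE rmorph1 oner_eq0 tofrac1 divr1.
by rewrite tofrac1 divr1.
Qed.

Lemma has_reductionM f1 f2 g1 g2 : has_reduction B f1 g1 ->
  has_reduction B f2 g2 -> has_reduction B (f1 * f2) (g1 * g2).
Proof.
move=> [p1 [q1 [q1n0 -> ->]]] [p2 [q2 [q2n0 -> ->]]]; exists (p1 * p2), (q1 * q2).
move: q1n0 q2n0; rewrite !reduce_polyE !rmorphM /= => q1n0 q2n0.
by split; [exact: mulf_neq0 | rewrite mulf_div | rewrite mulf_div].
Qed.

Lemma has_reductionD f1 f2 g1 g2 : has_reduction B f1 g1 ->
  has_reduction B f2 g2 -> has_reduction B (f1 + f2) (g1 + g2).
Proof.
have neq0 q : reduce_poly B q != 0 -> q%:F != 0.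
  by rewrite tofrac_eq0; apply: contra_neq => ->; rewrite reduce_polyE rmorph0.
move=> [p1 [q1 [q1n0 -> ->]]] [p2 [q2 [q2n0 -> ->]]].
exists (p1 * q2 + p2 * q1), (q1 * q2).
have /neq0 q1F := q1n0; have /neq0 q2F := q2n0.
move: q1n0 q2n0; rewrite !reduce_polyE => q1n0 q2n0.
have q1B : (pullback Br q1)%:F != 0 by rewrite tofrac_eq0.
have q2B : (pullback Br q2)%:F != 0 by rewrite tofrac_eq0.
rewrite comp_mpolyD ![pullback Br (_ * _)]rmorphM /=; split.
- exact: mulf_neq0.
- by rewrite (addf_div _ _ q1F q2F) tofracD !tofracM.
- by rewrite (addf_div _ _ q1B q2B) tofracD !tofracM.
Qed.

Lemma has_reduction_fconst c : has_reduction B (fconst c) (fconst c).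
Proof.
by have := has_reduction_tofrac c%:MP; rewrite reduce_polyE comp_mpolyC.
Qed.

Lemma has_reduction_sum (I : Type) (r : seq I)
    (F : I -> {fraction {mpoly K[n.+1]}}) (G : I -> {fraction {mpoly K[n]}}) :
  (forall i, has_reduction B (F i) (G i)) ->
  has_reduction B (\sum_(i <- r) F i) (\sum_(i <- r) G i).
Proof.
move=> FG; apply: (big_ind2 (has_reduction B)) => //.
- have := has_reduction_fconst 0; rewrite /fconst !mpolyC0.
  by rewrite !tofrac0.
- by move=> *; apply: has_reductionD.
Qed.

(** By [divides_reduce], a denominator prime to alpha_H is exactly one that stays nonzero on H. *)
Lemma has_reduction_regular f :
  regular_at (linpoly h) f -> has_reduction B f (reduce_frac B f).
Proof.
move=> [p [q [qh fq]]].
have q0 : reduce_poly B q != 0 by apply/eqP => /divides_reduce.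
have fred : has_reduction B f ((reduce_poly B p)%:F / (reduce_poly B q)%:F).
  exists p, q; split=> //; rewrite -fq mulfK // tofrac_eq0.
  by apply/eqP => qE; apply: qh; rewrite qE; apply: divides0.
by rewrite (reduce_frac_has fred).
Qed.

Lemma has_reduction_eq0 f : has_reduction B f 0 ->
  exists p q : {mpoly K[n.+1]},
    reduce_poly B q != 0 /\ f = (linpoly h * p)%:F / q%:F.
Proof.
move=> [p [q [q0 -> /eqP]]].
rewrite eq_sym mulf_eq0 invr_eq0 !tofrac_eq0 (negPf q0) orbF.
by move=> /eqP/divides_reduce[r ->]; exists r, q; rewrite [linpoly h * r]mulrC.
Qed.

Lemma coef_dy_contract omega j : coef_dy B omega j = contract omega (row j B).
Proof. by apply: eq_bigr => i _; rewrite mxE. Qed.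

Lemma row_incl j : row j Br = row (lift ord0 j) B.
Proof. by apply/rowP => i; rewrite !mxE. Qed.

Lemma contract_restrict omega u :
  (forall j, no_pole_along_H B (coef_dy B omega (lift ord0 j))) ->
  has_reduction B (contract omega (u *m Br)) (contract (restrict_form B omega) u).
Proof.
move=> pole; rewrite contract_mulmx; apply: has_reduction_sum => j.
rewrite mulrC; apply: has_reductionM; last exact: has_reduction_fconst.
rewrite mxE row_incl -coef_dy_contract; have [g gP] := pole j.
by rewrite (reduce_frac_has gP).
Qed.

End Reduction.

(** * Poles of the restricted form along the hyperplanes of H *)

Section PolesOfRestriction.
Context {K : fieldType} {n : nat}.
Variables (A : {fset {vspace 'rV[K]_n.+1}}) (m : multiplicity K n.+1)
  (alpha : formchoice K n.+1) (H : {vspace 'rV[K]_n.+1}) (B : 'M[K]_n.+1).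
Hypotheses (A_arr : is_arrangement A) (alphaA : defining_forms A alpha)
  (H_in : H \in A) (B_adapted : adapted_basis (alpha H) B).

Local Notation a L := (col_of_form (alpha L)).
Local Notation Br := (row' ord0 B).

Lemma arrangement_proper L : L \in A -> L != fullv.
Proof.
move=> /A_arr dL; apply/eqP => LE; move: dL; rewrite LE dimvf /dim /= mul1n.
by move/esym/n_Sn.
Qed.

Lemma arrangement_sub_eq L L' :
  L \in A -> L' \in A -> (L <= L')%VS -> L = L'.
Proof.
move=> /A_arr dL /A_arr dL' LL'; apply/eqP; rewrite eqEdim LL' /=.
by rewrite -ltnS dL dL'.
Qed.

Lemma mem_form L v : L \in A -> (v \in L) = (v *m a L == 0).
Proof. exact: mem_hyperplane. Qed.

Lemma distinct_forms L L' : L \in A -> L' \in A -> L' != L ->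
  ~ divides (linpoly (a L)) (linpoly (a L')).
Proof.
move=> AL AL' /eqP neq /divides_linpoly sub; apply: neq; apply/esym.
apply: arrangement_sub_eq => //; apply/subvP => v.
rewrite !mem_form // => /eqP vL; apply/eqP; apply: sub => //.
exact: (form_neq0 alphaA arrangement_proper).
Qed.

Lemma incl_in_H (u : 'rV[K]_n) : u *m Br \in H.
Proof. by rewrite mem_form // -mulmxA (adapted_basis_row' B_adapted) mulmx0. Qed.

Lemma in_H_incl v : v \in H -> v = v *m col' ord0 (invmx B) *m Br.
Proof.
rewrite mem_form // => /eqP vh; rewrite -mulmxA (section_mul_incl B_adapted).
by rewrite mulmxBr mulmx1 mulmxA vh mul0mx subr0.
Qed.

Lemma incl_form_neq0 L : L \in A -> L != H -> Br *m a L != 0.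
Proof.
move=> AL; apply: contra_neq => BaL; apply/esym/arrangement_sub_eq => //.
apply/subvP => v /in_H_incl ->.
by rewrite mem_form // -mulmxA BaL mulmx0.
Qed.

Lemma incl_form_prime L :
  L \in A -> L != H -> prime_element (linpoly (Br *m a L)).
Proof. by move=> AL LH; apply: linpoly_prime; apply: incl_form_neq0. Qed.

Lemma reduce_prod (P : pred {vspace 'rV[K]_n.+1}) :
  reduce_poly B (\prod_(L <- A | P L) linpoly (a L) ^+ m L)
  = \prod_(L <- A | P L) linpoly (Br *m a L) ^+ m L.
Proof.
rewrite reduce_polyE rmorph_prod; apply: eq_bigr => L _ /=.
by rewrite rmorphXn /= pullback_linpoly.
Qed.

Section LogarithmicForm.
Variable omega : ratform K n.+1.
Hypothesis omega_log : log_form A alpha m omega.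

Lemma integral_contract v :
  integral ((defpoly A alpha m)%:F * contract omega v).
Proof.
by have [Qint _] := (log_formP m alphaA arrangement_proper omega).1 omega_log.
Qed.

Lemma integral_contract_in L v : L \in A -> v \in L ->
  integral ((defpoly_but A alpha m L)%:F * contract omega v).
Proof.
have [_ Qint] := (log_formP m alphaA arrangement_proper omega).1 omega_log.
exact: Qint.
Qed.

Lemma ndivides_defpoly_but L : L \in A ->
  ~ divides (linpoly (a L)) (defpoly_but A alpha m L).
Proof.
move=> AL; apply: prime_element_prod_in.
  exact: (form_prime alphaA arrangement_proper).
by move=> L' AL' L'L; apply: distinct_forms.
Qed.

(** The cofactor Q / alpha_L^m(L) is prime to alpha_L, so dividing by it creates no pole along L. *)
Lemma regular_contract_in L v : L \in A -> v \in L ->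
  regular_at (linpoly (a L)) (contract omega v).
Proof.
move=> AL vL; have aL := form_prime alphaA arrangement_proper AL.
apply: (regular_at_divl aL (ndivides_defpoly_but AL)).
by apply: regular_at_integral => //; apply: integral_contract_in.
Qed.

Lemma regular_contract L v : L \in A ->
  regular_at (linpoly (a L)) ((linpoly (a L) ^+ m L)%:F * contract omega v).
Proof.
move=> AL; have aL := form_prime alphaA arrangement_proper AL.
apply: (regular_at_divl aL (ndivides_defpoly_but AL)).
rewrite mulrA -tofracM [_ * linpoly _ ^+ _]mulrC -defpoly_split //.
exact: regular_at_integral (integral_contract v).
Qed.

Lemma no_pole_contract v : v \in H -> no_pole_along_H B (contract omega v).
Proof.
move=> vH; exists (reduce_frac B (contract omega v)).
by apply: (has_reduction_regular B_adapted); apply: regular_contract_in.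
Qed.

Lemma no_pole_coef_dy j : no_pole_along_H B (coef_dy B omega (lift ord0 j)).
Proof.
rewrite coef_dy_contract -row_incl rowE; apply: no_pole_contract.
exact: incl_in_H.
Qed.

Local Notation omegaH := (restrict_form B omega).

Lemma contract_omegaH u :
  has_reduction B (contract omega (u *m Br)) (contract omegaH u).
Proof. exact/contract_restrict/no_pole_coef_dy. Qed.

(** A crude bound, obtained by reducing the polynomial (Q / alpha_H^m(H)) omega(v) for v in H. It
    confines the poles to the traces [L :&: H], which can then be treated one at a time. *)
Lemma integral_omegaH u : integral (contract omegaH u *
  (\prod_(L <- A | L != H) linpoly (Br *m a L) ^+ m L)%:F).
Proof.
have [p pE] := integral_contract_in H_in (incl_in_H u).
exists (reduce_poly B p).
apply: (has_reduction_uniq _ (has_reduction_tofrac B p)).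
rewrite -pE [contract omegaH u * _]mulrC -reduce_prod.
by apply: has_reductionM (has_reduction_tofrac _ _) (contract_omegaH u).
Qed.

(* Only the hyperplanes containing L :&: H restrict to the zero locus of
   alpha_L on H, so the remaining denominators of f stay units there. *)
Lemma regular_restriction L f g : L \in A -> L != H ->
  integral ((defpoly A alpha m)%:F * f) ->
  (forall L', L' \in A -> (L :&: H <= L')%VS -> regular_at (linpoly (a L')) f) ->
  has_reduction B f g -> regular_at (linpoly (Br *m a L)) g.
Proof.
move=> AL LH Qf freg fg.
pose U := \prod_(L' <- A | ~~ (L :&: H <= L')%VS) linpoly (a L') ^+ m L'.
have [p pE] : integral (f * U%:F).
  apply: (integral_of_regular (r := enum_fset A) (P := fun L' => (L :&: H <= L')%VS)
            (a := fun L' => linpoly (a L')) (N := m)).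
  - by move=> L' AL' _; apply: (form_prime alphaA arrangement_proper).
  - move=> L' AL' XL'; have aL' := form_prime alphaA arrangement_proper AL'.
    by apply: regular_atM => //; [apply: freg | apply: regular_at_tofrac].
  congr integral: Qf; rewrite defpolyE.
  rewrite (bigID (fun L' => (L :&: H <= L')%VS)) /= tofracM -/U.
  by rewrite mulrC mulrA mulrAC.
have aBL := incl_form_prime AL LH.
(* Divisibility would make some alpha_L' occurring in U vanish on [L :&: H], against the choice of
   U. *)
have UB : ~ divides (linpoly (Br *m a L)) (reduce_poly B U).
  rewrite reduce_prod; apply: prime_element_prod_in => // L' AL' /negP XL'.
  move/(divides_linpoly (incl_form_neq0 AL LH)) => sub; apply: XL'.
  apply/subvP => v /[!memv_cap]/andP[vL /in_H_incl vE].
  rewrite mem_form // vE -mulmxA; apply/eqP; apply: sub.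
  by apply/eqP; rewrite mulmxA -vE -mem_form.
exists (reduce_poly B p), (reduce_poly B U); split=> //.
apply: (has_reduction_uniq _ (has_reduction_tofrac B p)).
by rewrite -pE; apply: has_reductionM fg _; apply: has_reduction_tofrac.
Qed.

(** The vector lies in [L :&: H], hence in every hyperplane containing it, and along each of these
    omega has no pole in this direction. *)
Lemma regular_omegaH_in L u : L \in A -> L != H -> u *m Br \in L ->
  regular_at (linpoly (Br *m a L)) (contract omegaH u).
Proof.
move=> AL LH uL; apply: regular_restriction (contract_omegaH u) => //.
  exact: integral_contract.
move=> L' AL' /subvP XL'; apply: regular_contract_in => //.
by apply: XL'; rewrite memv_cap uL incl_in_H.
Qed.

End LogarithmicForm.

End PolesOfRestriction.

(** * The pole bound by the Euler multiplicity, through the plane V/X *)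

Lemma exists_split2 {K : fieldType} (b : 'cV[K]_2) : b != 0 ->
  exists (w e : 'rV[K]_2) (e' : 'cV[K]_2),
    [/\ w *m b = 1, e *m b = 0, e *m e' = 1 & 1%:M - b *m w = e' *m e].
Proof.
move=> b0; have [w wb] := exists_dual b0.
have wbE : w 0 0 * b 0 0 + w 0 1 * b 1 0 = 1.
  have := congr1 (fun M : 'M[K]_1 => M 0 0) wb.
  rewrite !mxE big_ord_recl big_ord1 /= mulr1n => <-.
  by have -> : lift ord0 ord0 = 1 :> 'I_2 by apply: val_inj.
have b01 : forall i : 'I_2, i = 0 \/ i = 1.
  by case=> [[|[|i]]] // lti; [left|right]; apply: val_inj.
(* Both b and w are rotated by a right angle: e spans the kernel of b, and e e' is again w b = 1.
   The projection onto the kernel of b along w thus has rank one. *)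
pose e : 'rV[K]_2 := \row_j (if j == 0 then b 1 0 else - b 0 0).
pose e' : 'cV[K]_2 := \col_j (if j == 0 then w 0 1 else - w 0 0).
exists w, e, e'; split=> //.
- apply/rowP => j; rewrite ord1 !mxE big_ord_recl big_ord1 !mxE /=.
  have -> : lift ord0 ord0 = 1 :> 'I_2 by apply: val_inj.
  by ring.
- apply/rowP => j; rewrite ord1 !mxE big_ord_recl big_ord1 !mxE /=.
  by rewrite mulr1n -wbE; ring.
- apply/matrixP => i j; rewrite !mxE !big_ord1 !mxE.
  by case: (b01 i) => ->; case: (b01 j) => ->;
    rewrite /= ?mulr1n ?mulr0n -?wbE; ring.
Qed.

Lemma der_apply_linpoly {K : fieldType} l (theta : derivation K l) (b : 'cV[K]_l) :
  der_apply theta (linpoly b) = \sum_i theta 0 i * (b i 0)%:MP.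
Proof.
apply: eq_bigr => i _; congr (_ * _); apply: tofrac_inj.
by have := ext_d_linpoly b i; rewrite mxE.
Qed.

Section EulerBound.
Context {K : fieldType} {n : nat}.
Variables (A : {fset {vspace 'rV[K]_n.+1}}) (m : multiplicity K n.+1)
  (alpha : formchoice K n.+1) (H : {vspace 'rV[K]_n.+1}) (B : 'M[K]_n.+1).
Hypotheses (A_arr : is_arrangement A) (alphaA : defining_forms A alpha)
  (H_in : H \in A) (m_H : (0 < m H)%N) (B_adapted : adapted_basis (alpha H) B).

Local Notation a L := (col_of_form (alpha L)).
Local Notation Br := (row' ord0 B).

Variable omega : ratform K n.+1.
Hypothesis omega_log : log_form A alpha (mult_sub m H) omega.
Local Notation omegaH := (restrict_form B omega).

Variable L : {vspace 'rV[K]_n.+1}.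
Hypotheses (AL : L \in A) (LH : L != H).
Local Notation X := (L :&: H)%VS.

Variables (pi : 'Hom('rV[K]_n.+1, 'rV[K]_2)) (alphae : formchoice K 2)
  (theta : derivation K 2) (d : nat).
Hypotheses (pi_ker : lker pi = X) (pi_img : limg pi = fullv)
  (alphaeP : forall L', L' \in A -> (X <= L')%VS ->
     lker (alphae (pi @: L')%VS) = (pi @: L')%VS)
  (theta_log : forall L', L' \in A -> (X <= L')%VS ->
     exists q, der_apply theta (poly_of_form (alphae (pi @: L')%VS))
               = q * poly_of_form (alphae (pi @: L')%VS) ^+ m L')
  (theta_homog : der_homogeneous d theta)
  (theta_ndiv : ~ der_divides (poly_of_form (alphae (pi @: H)%VS)) theta).

Local Notation ae L' := (col_of_form (alphae (pi @: L')%VS)).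
Local Notation Pi := (lin1_mx pi).
Local Notation Sg := (\matrix_i (pi^-1)%VF (delta_mx 0 i)).

Lemma X_sub_L : (X <= L)%VS. Proof. exact: capvSl. Qed.
Lemma X_sub_H : (X <= H)%VS. Proof. exact: capvSr. Qed.

(** The rows of [Sg] are preimages of the standard basis of K^2, which exist because pi is
    surjective. *)
Lemma section_mul_proj : Sg *m Pi = 1%:M :> 'M[K]_2.
Proof.
apply/row_matrixP => i; rewrite row_mul rowK mul_rV_lin1 /= limg_lfunVK.
  by rewrite rowE mulmx1.
by rewrite pi_img memvf.
Qed.

Lemma mem_X v : (v \in X) = (v *m Pi == 0).
Proof. by rewrite -pi_ker memv_ker mul_rV_lin1. Qed.

Lemma mem_proj_form L' v : L' \in A -> (X <= L')%VS ->
  (v \in L') = (v *m Pi *m ae L' == 0).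
Proof.
move=> AL' /subvP XL'; rewrite mul_rV_lin1 /= -mem_lker_form alphaeP //; last first.
  exact/subvP.
apply/idP/idP => [|/memv_imgP[v' v'L' piv]]; first exact: memv_img.
rewrite -[v](subrK v') memvD // XL' //.
by rewrite -pi_ker memv_ker linearB /= piv subrr.
Qed.

Lemma proj_form_neq0 L' : L' \in A -> (X <= L')%VS -> ae L' != 0.
Proof.
move=> AL' XL'; apply/eqP => ae0.
have /eqP[] := arrangement_proper A_arr AL'; apply/vspaceP => v.
by rewrite memvf (mem_proj_form _ AL' XL') ae0 mulmx0 eqxx.
Qed.

(** Both forms have kernel L'. Those on V/X are chosen independently of alpha, so equality cannot be
    expected. *)
Lemma proj_form_proportional L' : L' \in A -> (X <= L')%VS ->
  exists c, Pi *m ae L' = c *: a L'.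
Proof.
move=> AL' XL'; apply: kernel_proportional => [|v va].
  exact: (form_neq0 alphaA (arrangement_proper A_arr)).
apply/eqP; rewrite mulmxA -(mem_proj_form v AL' XL').
by rewrite (mem_form alphaA) // va.
Qed.

(* The pairing of omega with the lift of theta along a section of pi *)
Definition pairing : {fraction {mpoly K[n.+1]}} :=
  \sum_i (pullback Pi (theta 0 i))%:F * contract omega (row i Sg).

(** The i-th basis vector of K^2 is b_i w plus a remainder, and the multiples of w add up to
    theta(b) w. When w b = 1, the remainders lie in the kernel of b. *)
Lemma pairing_split (b : 'cV[K]_2) (w : 'rV[K]_2) : pairing =
  (pullback Pi (der_apply theta (linpoly b)))%:F * contract omega (w *m Sg)
  + \sum_i (pullback Pi (theta 0 i))%:F
           * contract omega (row i (1%:M - b *m w) *m Sg).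
Proof.
rewrite der_apply_linpoly linear_sum raddf_sum mulr_suml -big_split /=.
apply: eq_bigr => i _; rewrite rmorphM /= comp_mpolyC tofracM -/(fconst _).
rewrite -mulrA -contractZr -mulrDr -contractDr; congr (_ * contract _ _).
rewrite linearB /= mulmxBl -row_mul mul1mx; have -> : row i (b *m w) = b i 0 *: w.
  by apply/rowP => j; rewrite !mxE big_ord1.
by rewrite -scalemxAl addrC subrK.
Qed.

Lemma pullback_theta_form L' : L' \in A -> (X <= L')%VS ->
  exists q, pullback Pi (der_apply theta (linpoly (ae L')))
            = q * linpoly (a L') ^+ m L'.
Proof.
move=> AL' XL'; have [q] := theta_log AL' XL'; rewrite poly_of_formE => ->.
have [c cE] := proj_form_proportional AL' XL'.
exists (pullback Pi q * (c ^+ m L')%:MP); rewrite rmorphM rmorphXn /=.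
by rewrite pullback_linpoly cE linpolyZ exprZn -mul_mpolyC mulrA.
Qed.

(** Split along the form of L'. In the first term theta contributes alpha_L'^m(L'), which cancels
    the pole of omega(w); the vectors in the second term lie in L', where omega has no pole along
    L'. *)
Lemma regular_pairing L' : L' \in A -> (X <= L')%VS ->
  regular_at (linpoly (a L')) pairing.
Proof.
move=> AL' XL'.
have aL' := form_prime alphaA (arrangement_proper A_arr) AL'.
have [w wb] := exists_dual (proj_form_neq0 AL' XL').
rewrite (pairing_split (ae L') w); apply: regular_atD => //.
  have [q ->] := pullback_theta_form AL' XL'.
  (* Subtraction is truncated, so at L' = H the identity rests on m(H) > 0. *)
  have -> : m L' = ((L' == H) + mult_sub m H L')%N.
    rewrite /mult_sub subnKC //; case: eqP => // ->; exact: m_H.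
  rewrite exprD mulrA [X in regular_at _ (X * _)]tofracM -mulrA.
  apply: regular_atM => //; first exact: regular_at_tofrac.
  exact: (regular_contract A_arr alphaA omega_log).
apply: regular_at_sum => // i _; apply: regular_atM => //.
  exact: regular_at_tofrac.
apply: (regular_contract_in A_arr alphaA omega_log) => //.
rewrite (mem_proj_form _ AL' XL') -[_ *m Sg *m _]mulmxA section_mul_proj mulmx1.
by rewrite -row_mul mulmxBl mul1mx -mulmxA wb mulmx1 subrr row0.
Qed.

Lemma regular_omegaH u : regular_at (linpoly (Br *m a L))
  ((linpoly (Br *m a L) ^+ d)%:F * contract omegaH u).
Proof.
have aBL := incl_form_prime A_arr alphaA H_in B_adapted AL LH.
have [w [e [e' [wb eb ee' wE]]]] := exists_split2 (proj_form_neq0 H_in X_sub_H).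
(* With b = [ae H], this gives theta = theta(b) w + f e, where e spans the line [pi @: H]. *)
pose f := \sum_i theta 0 i * (e' i 0)%:MP.
have f_homog : f \is d.-homog.
  by apply: rpred_sum => i _; rewrite mulrC mul_mpolyC rpredZ.
pose fe := f.@[fun i => e 0 i].
have fe0 : fe != 0.
  (* If f vanishes at e, then b divides f. It also divides theta(b) because m(H) > 0, hence it
     divides theta, with quotient s w + r e. *)
  apply/eqP => fe0; apply: theta_ndiv; rewrite poly_of_formE.
  have [r rE] : divides (linpoly (ae H)) f.
    apply/(divides_linpolyE _ wb).
    by rewrite wE (pullback_homog _ _ f_homog) -/fe fe0 scale0r.
  have [q] := theta_log H_in X_sub_H; rewrite poly_of_formE der_apply_linpoly.
  rewrite -(prednK m_H) exprS mulrCA => qE.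
  pose s := q * linpoly (ae H) ^+ (m H).-1.
  exists (\row_j (s * (w 0 j)%:MP + r * (e 0 j)%:MP)).
  apply/rowP => j; rewrite !mxE mulrDr mulrA -qE mulrA [_ * r]mulrC -rE.
  rewrite /f !mulr_suml -big_split /=.
  transitivity (\sum_i theta 0 i * ((1%:M : 'M[K]_2) i j)%:MP).
    rewrite (bigD1 j) //= mxE eqxx mpolyC1 mulr1 big1 ?addr0 // => i ij.
    by rewrite mxE (negPf ij) mpolyC0 mulr0.
  apply: eq_bigr => i _; rewrite -!mulrA -mulrDr -!mpolyCM -mpolyCD.
  have := congr1 (fun M : 'M[K]_2 => M i j) wE; rewrite !mxE !big_ord1.
  by move/eqP; rewrite subr_eq => /eqP ->; rewrite [X in X%:MP]addrC mxE.
(* The map from H to V/X has image in the line spanned by e; beta is its coordinate there, a form on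
   H with kernel [L :&: H]. *)
pose beta := Br *m Pi *m e'.
have BrPi : Br *m Pi = beta *m e.
  rewrite /beta -[RHS]mulmxA -wE mulmxBr mulmx1 mulmxA -[Br *m Pi *m _]mulmxA.
  have [c ->] := proj_form_proportional H_in X_sub_H.
  by rewrite -scalemxAr (adapted_basis_row' B_adapted) scaler0 mul0mx subr0.
have mem_beta v : v *m beta = 0 -> v *m Br \in X.
  by move=> vb; rewrite mem_X -mulmxA BrPi mulmxA vb mul0mx.
have in_H := incl_in_H alphaA H_in B_adapted.
have memL v := mem_form alphaA v AL.
have [c betaE] : exists c, beta = c *: (Br *m a L).
  apply: kernel_proportional.
    exact: (incl_form_neq0 A_arr alphaA H_in B_adapted AL LH).
  move=> v va; have : v *m Br \in X.
    by rewrite memv_cap in_H andbT memL -mulmxA va.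
  by rewrite mem_X /beta !mulmxA => /eqP->; rewrite mul0mx.
(* Otherwise beta = 0, which puts all of H inside L. *)
have c0 : c != 0.
  apply: contra_neq (incl_form_neq0 A_arr alphaA H_in B_adapted AL LH) => c0.
  apply/row_matrixP => i; rewrite row0 rowE mulmxA; apply/eqP; rewrite -memL.
  have := mem_beta (delta_mx 0 i).
  by rewrite memv_cap betaE c0 scale0r mulmx0 => /(_ erefl)/andP[].
(* The coordinates on H of the lift of e, a vector spanning H modulo [L :&: H]. *)
pose ue := e *m Sg *m col' ord0 (invmx B).
have ueE : ue *m Br = e *m Sg.
  rewrite -(in_H_incl alphaA H_in B_adapted) //.
  rewrite (mem_proj_form _ H_in X_sub_H) -[e *m Sg *m _]mulmxA section_mul_proj.
  by rewrite mulmx1 eb.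
have red := contract_omegaH A_arr alphaA H_in B_adapted omega_log.
(* Modulo alpha_H the first term of the splitting dies: theta(b) carries alpha_H^m(H), whereas
   omega(w) has pole order at most m(H) - 1 along H. *)
have pairing_red : has_reduction B pairing
    ((reduce_poly B (pullback Pi f))%:F * contract omegaH ue).
  rewrite (pairing_split (ae H) w) -[X in has_reduction _ _ X]add0r.
  apply: has_reductionD.
    have [q ->] := pullback_theta_form H_in X_sub_H.
    rewrite -(prednK m_H) exprS mulrCA tofracM tofracM -!mulrA.
    have -> : (m H).-1 = mult_sub m H H by rewrite /mult_sub eqxx subn1.
    have := regular_contract A_arr alphaA omega_log (w *m Sg) H_in.
    move/(has_reduction_regular B_adapted) => redw.
    have := has_reductionM (has_reduction_tofrac B (linpoly (a H)))
      (has_reductionM (has_reduction_tofrac B q) redw).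
    by rewrite (reduce_poly_form B_adapted) tofrac0 mul0r.
  rewrite wE.
  have -> : \sum_i (pullback Pi (theta 0 i))%:F
                   * contract omega (row i (e' *m e) *m Sg)
      = (pullback Pi f)%:F * contract omega (e *m Sg).
    rewrite /f linear_sum raddf_sum mulr_suml /=; apply: eq_bigr => i _.
    rewrite rmorphM /= comp_mpolyC tofracM -/(fconst _) -mulrA -contractZr.
    congr (_ * contract _ _); rewrite scalemxAl; congr (_ *m _).
    by apply/rowP => j; rewrite !mxE big_ord1.
  by rewrite -ueE; apply: has_reductionM (red ue); apply: has_reduction_tofrac.
(* On H the pullback of f becomes f(e) beta^d. As beta is proportional to alpha_L there, this is
   alpha_L^d times the nonzero constant k. *)
have reg_ue : regular_at (linpoly (Br *m a L))
    ((linpoly (Br *m a L) ^+ d)%:F * contract omegaH ue).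
  have := regular_restriction A_arr alphaA H_in B_adapted AL LH _ regular_pairing
    pairing_red.
  rewrite reduce_polyE pullback_comp BrPi (pullback_homog _ _ f_homog) -/fe.
  rewrite betaE linpolyZ exprZn scalerA.
  set k := fe * _; have k0 : k != 0 by rewrite mulf_neq0 ?expf_neq0.
  move=> reg; have {reg} : regular_at (linpoly (Br *m a L))
    ((k *: linpoly (Br *m a L) ^+ d)%:F * contract omegaH ue).
    apply: reg; rewrite /pairing mulr_sumr; apply: integral_sum => i _.
    rewrite mulrCA; apply: integralM; first exact: integral_tofrac.
    exact: (integral_contract A_arr alphaA omega_log).
  move/(regular_atM aBL (regular_at_tofrac (k^-1)%:MP aBL)).
  by rewrite mulrA -tofracM mul_mpolyC scalerA mulVf ?scale1r.
(* Subtracting the component along [ue] leaves a vector of [L :&: H], on which there is no pole at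
   all along L. *)
pose u' := u - (u *m beta) 0 0 *: ue.
have -> : u = (u *m beta) 0 0 *: ue + u' by rewrite addrC subrK.
rewrite contractDr contractZr mulrDr; apply: regular_atD => //.
  by rewrite mulrCA; apply: regular_atM => //; apply: regular_at_tofrac.
apply: regular_atM => //; first exact: regular_at_tofrac.
apply: (regular_omegaH_in A_arr alphaA H_in B_adapted omega_log) => //.
apply: (subvP X_sub_L); rewrite mem_X mulmxBl mulmxBl -!scalemxAl ueE.
rewrite -[e *m Sg *m _]mulmxA section_mul_proj mulmx1.
rewrite -[u *m _ *m _]mulmxA BrPi mulmxA.
by rewrite {1}[u *m beta]mx11_scalar mul_scalar_mx subrr.
Qed.

End EulerBound.

(** * The restricted form is logarithmic for the Euler multiplicity *)

Section RestrictionIsLogarithmic.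
Context {K : fieldType} {n : nat}.
Variables (A : {fset {vspace 'rV[K]_n.+1}}) (m : multiplicity K n.+1)
  (alpha : formchoice K n.+1) (H : {vspace 'rV[K]_n.+1})
  (mstar : multiplicity K n.+1) (B : 'M[K]_n.+1) (alphaH : formchoice K n).
Hypotheses (A_arr : is_arrangement A) (alphaA : defining_forms A alpha)
  (H_in : H \in A) (m_H : (0 < m H)%N)
  (mstar_euler : is_euler_multiplicity A m H mstar)
  (B_adapted : adapted_basis (alpha H) B)
  (alphaHP : defining_forms (arr_in_coords B (restriction A H)) alphaH).

Local Notation a L := (col_of_form (alpha L)).
Local Notation Br := (row' ord0 B).
Local Notation AH := (arr_in_coords B (restriction A H)).
Local Notation Y L := (incl B @^-1: (L :&: H))%VS.

Lemma inclE u : incl B u = u *m Br.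
Proof. by rewrite lfunE. Qed.

Lemma mem_restriction_coords L : L \in A -> L != H -> Y L \in AH.
Proof.
move=> AL LH; apply/imfsetP; exists (L :&: H)%VS => //=.
by apply/imfsetP; exists L => //=; rewrite !inE LH.
Qed.

Lemma restriction_coordsP Z : Z \in AH ->
  exists L, [/\ L \in A, L != H & Z = Y L].
Proof.
case/imfsetP => /= _ /imfsetP[/= L + ->] -> => /[!inE] /andP[LH AL].
by exists L.
Qed.

Lemma mem_Y L u : L \in A -> (u \in Y L) = (u *m (Br *m a L) == 0).
Proof.
move=> AL; rewrite -memv_preim inclE memv_cap (incl_in_H alphaA H_in B_adapted).
by rewrite andbT (mem_form alphaA) // mulmxA.
Qed.

Lemma restriction_proper Z : Z \in AH -> Z != fullv.
Proof.
case/restriction_coordsP => L [AL LH ->]; apply/eqP => /vspaceP YE.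
have /eqP[] := incl_form_neq0 A_arr alphaA H_in B_adapted AL LH.
apply/row_matrixP => i; rewrite row0 rowE; apply/eqP.
by rewrite -mem_Y // YE memvf.
Qed.

Lemma restriction_form_proportional L : L \in A -> L != H ->
  exists c, col_of_form (alphaH (Y L)) = c *: (Br *m a L).
Proof.
move=> AL LH; apply: kernel_proportional.
  exact: (incl_form_neq0 A_arr alphaA H_in B_adapted AL LH).
move=> u /eqP; rewrite -mem_Y // => uY; apply/eqP.
by rewrite -mem_lker_form (alphaHP (mem_restriction_coords AL LH)).
Qed.

(** Since [L :&: H] lies in H, the image of [incl B], passing to coordinates and back recovers
    it. *)
Lemma mstar_in_coords L : mult_in_coords B mstar (Y L) = mstar (L :&: H)%VS.
Proof.
rewrite /mult_in_coords lpreimK //; apply/subvP => v.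
rewrite memv_cap => /andP[_ /(in_H_incl alphaA H_in B_adapted) ->].
by rewrite -inclE memv_img ?memvf.
Qed.

Section Form.
Variable omega : ratform K n.+1.
Hypothesis omega_log : log_form A alpha (mult_sub m H) omega.
Local Notation omegaH := (restrict_form B omega).

Lemma euler_regular L u : L \in A -> L != H ->
  regular_at (linpoly (Br *m a L))
    ((linpoly (Br *m a L) ^+ mstar (L :&: H)%VS)%:F * contract omegaH u).
Proof.
move=> AL LH; have XR : (L :&: H)%VS \in restriction A H.
  by apply/imfsetP; exists L => //=; rewrite !inE LH.
have [pi [alphae [theta [phi [e [[pi_ker pi_img] aeP [tlog _ _] [thom _] [tndiv _]]]]]]]
  := mstar_euler XR.
have in_loc L' : L' \in A -> (L :&: H <= L')%VS ->
    (pi @: L')%VS \in [fset (pi @: L0)%VS | L0 in localization A (L :&: H)%VS]%fset.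
  by move=> AL' XL'; apply/imfsetP; exists L' => //=; rewrite !inE AL'.
apply: (regular_omegaH A_arr alphaA H_in m_H B_adapted omega_log AL LH
          pi_ker pi_img _ _ thom tndiv).
  by move=> L' AL' XL'; apply: aeP; apply: in_loc.
move=> L' AL' XL'; have [q qE] := tlog _ (in_loc L' AL' XL').
(* The multiplicity on V/X is read off at the preimage of [pi @: L'], which is L' because L'
   contains the kernel of pi. *)
exists q; rewrite qE; congr (_ * _ ^+ m _); apply/vspaceP => v.
rewrite -memv_preim; apply/memv_imgP/idP => [[v' v'L' piv]|]; last by exists v.
rewrite -[v](subrK v') memvD // (subvP XL') // -pi_ker memv_ker.
by rewrite linearB /= piv subrr.
Qed.

Lemma euler_regular_form L u : L \in A -> L != H ->
  regular_at (linpoly (Br *m a L))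
    ((linpoly (col_of_form (alphaH (Y L))) ^+ mult_in_coords B mstar (Y L))%:F
     * contract omegaH u).
Proof.
move=> AL LH; have aBL := incl_form_prime A_arr alphaA H_in B_adapted AL LH.
have [c ->] := restriction_form_proportional AL LH.
rewrite mstar_in_coords linpolyZ exprZn -mul_mpolyC tofracM -mulrA.
by apply: regular_atM => //; [apply: regular_at_tofrac | apply: euler_regular].
Qed.

(** By [integral_omegaH], poles can occur only along the traces of the L. *)
Lemma integral_of_regular_omegaH (p : {mpoly K[n]}) u :
  (forall L, L \in A -> L != H ->
     regular_at (linpoly (Br *m a L)) (p%:F * contract omegaH u)) ->
  integral (p%:F * contract omegaH u).
Proof.
move=> reg; apply: (integral_of_regular (r := enum_fset A) (P := fun L => L != H)
  (a := fun L => linpoly (Br *m a L)) (N := mult_sub m H)).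
- by move=> L AL LH; apply: (incl_form_prime A_arr alphaA H_in B_adapted).
- by move=> L AL LH; apply: reg.
rewrite -mulrA; apply: integralM; first exact: integral_tofrac.
exact: (integral_omegaH A_arr alphaA H_in B_adapted omega_log).
Qed.

Lemma log_form_restrict :
  log_form AH alphaH (mult_in_coords B mstar) omegaH.
Proof.
apply/(log_formP _ alphaHP restriction_proper); split=> [u|Z u ZAH uZ].
  apply: integral_of_regular_omegaH => L AL LH.
  have aBL := incl_form_prime A_arr alphaA H_in B_adapted AL LH.
  rewrite (defpoly_split _ _ (mem_restriction_coords AL LH)) mulrC tofracM.
  rewrite mulrA [X in X * _]mulrC; apply: regular_atM => //.
    exact: euler_regular_form.
  exact: regular_at_tofrac.
apply: integral_of_regular_omegaH => L AL LH.
have aBL := incl_form_prime A_arr alphaA H_in B_adapted AL LH.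
(* Along Z itself the cofactor gives nothing, but u lies in Z and there is no pole in that
   direction. Along any other hyperplane the cofactor still contains the power with exponent
   [mstar]. *)
have [YZ|YZ] := eqVneq (Y L) Z.
  apply: regular_atM => //; first exact: regular_at_tofrac.
  apply: (regular_omegaH_in A_arr alphaA H_in B_adapted omega_log) => //.
  by rewrite (mem_form alphaA) // -mulmxA -mem_Y // YZ.
rewrite /defpoly_but (big_rem (Y L)) ?mem_restriction_coords //= YZ.
rewrite tofracM mulrAC; apply: regular_atM => //.
  exact: euler_regular_form.
exact: regular_at_tofrac.
Qed.

End Form.

End RestrictionIsLogarithmic.

(** * Multiplication and division by alpha_H *)

Section Exactness.
Context {K : fieldType} {n : nat}.
Variables (A : {fset {vspace 'rV[K]_n.+1}}) (m : multiplicity K n.+1)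
  (alpha : formchoice K n.+1) (H : {vspace 'rV[K]_n.+1}) (B : 'M[K]_n.+1).
Hypotheses (A_arr : is_arrangement A) (alphaA : defining_forms A alpha)
  (H_in : H \in A) (m_H : (0 < m H)%N) (B_adapted : adapted_basis (alpha H) B).

Local Notation a L := (col_of_form (alpha L)).
Local Notation Br := (row' ord0 B).

Lemma defpoly_but_sub :
  defpoly_but A alpha (mult_sub m H) H = defpoly_but A alpha m H.
Proof. by apply: eq_bigr => L /negPf LH; rewrite /mult_sub LH subn0. Qed.

Lemma defpoly_but_mult_sub L : L \in A -> L != H ->
  defpoly_but A alpha m L
  = linpoly (a H) * defpoly_but A alpha (mult_sub m H) L.
Proof.
move=> AL LH; have but_split m' : defpoly_but A alpha m' L = linpoly (a H) ^+ m' H *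
    \prod_(L' <- rem H A | L' != L) linpoly (a L') ^+ m' L'.
  by rewrite /defpoly_but (big_rem H H_in) eq_sym LH.
have tailE : \prod_(L' <- rem H A | L' != L) linpoly (a L') ^+ m L' =
    \prod_(L' <- rem H A | L' != L) linpoly (a L') ^+ mult_sub m H L'.
  rewrite big_seq_cond [RHS]big_seq_cond; apply: eq_bigr => L' /andP[].
  rewrite mem_rem_uniq ?fset_uniq // inE => /andP[/negPf L'H _] _.
  by rewrite /mult_sub L'H subn0.
have mH : mult_sub m H H = (m H).-1 by rewrite /mult_sub eqxx subn1.
by rewrite !but_split tailE mulrA -exprS mH prednK.
Qed.

Lemma defpoly_mult_sub : defpoly A alpha m
  = linpoly (a H) * defpoly A alpha (mult_sub m H).
Proof.
rewrite !(defpoly_split alpha _ H_in) defpoly_but_sub mulrA -exprS.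
by rewrite /mult_sub eqxx subn1 prednK.
Qed.

Let log_formPm m' := log_formP m' alphaA (arrangement_proper A_arr).

Lemma log_form_mul omega : log_form A alpha m omega ->
  log_form A alpha (mult_sub m H) ((linpoly (a H))%:F *: omega).
Proof.
case/log_formPm => Qint Lint; apply/log_formPm.
split=> [v|L v AL vL]; rewrite contractZl mulrA [X in X * _]mulrC -tofracM.
  by rewrite -defpoly_mult_sub.
(* For L other than H, the factor alpha_H completes the cofactor for m' to the one for m. For L = H
   the two cofactors agree, and alpha_H is an extra polynomial factor. *)
have [LH|LH] := eqVneq L H; last by rewrite -defpoly_but_mult_sub //; apply: Lint.
rewrite LH defpoly_but_sub tofracM -mulrA; apply: integralM.
  exact: integral_tofrac.
by apply: Lint => //; rewrite -LH.
Qed.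

Lemma form_fraction_neq0 : (linpoly (a H))%:F != 0.
Proof.
by rewrite tofrac_eq0; apply: (linform_neq0 alphaA (arrangement_proper A_arr)).
Qed.

(** In the directions of H, omega itself has no pole along H, so its product with alpha_H reduces to
    0. *)
Lemma restrict_form_mul omega : log_form A alpha m omega ->
  restrict_form B ((linpoly (a H))%:F *: omega) = 0.
Proof.
move=> omega_log; apply/rowP => j; rewrite !mxE coef_dy_contract contractZl.
have rH : row (lift ord0 j) B \in H.
  by rewrite -row_incl rowE; apply: (incl_in_H alphaA H_in B_adapted).
have := has_reduction_regular B_adapted
  (regular_contract_in A_arr alphaA omega_log H_in rH).
move/(has_reductionM (has_reduction_tofrac B (linpoly (a H)))).
rewrite (reduce_poly_form B_adapted) tofrac0 mul0r => red.
exact: (reduce_frac_has red).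
Qed.

(** Vanishing of the restriction enters at L = H: for v in H it makes omega(v) a multiple of alpha_H
    locally at H, so dividing by alpha_H creates no pole. *)
Lemma log_form_div omega : log_form A alpha (mult_sub m H) omega ->
  restrict_form B omega = 0 ->
  log_form A alpha m (((linpoly (a H))%:F)^-1 *: omega).
Proof.
move=> omega_log res0; have aH0 := form_fraction_neq0.
have [Qint Lint] := (log_formPm _ _).1 omega_log.
apply/log_formPm; split=> [v|L v AL vL]; rewrite contractZl.
  rewrite defpoly_mult_sub [linpoly _ * _]mulrC tofracM -mulrA mulVKf //.
have [LH|LH] := eqVneq L H; last first.
  rewrite defpoly_but_mult_sub // [linpoly _ * _]mulrC tofracM -mulrA mulVKf //.
  exact: Lint.
rewrite LH in vL *.
have aHprime := form_prime alphaA (arrangement_proper A_arr) H_in.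
have red := contract_omegaH A_arr alphaA H_in B_adapted omega_log
  (v *m col' ord0 (invmx B)).
rewrite -(in_H_incl alphaA H_in B_adapted) // in red.
have {red} [p [q [q0 fE]]] : exists p q : {mpoly K[n.+1]}, reduce_poly B q != 0 /\
    contract omega v = (linpoly (a H) * p)%:F / q%:F.
  apply: (has_reduction_eq0 B_adapted); move: red.
  by rewrite res0 -(scale0r 0) contractZl mul0r.
have reg : regular_at (linpoly (a H))
    ((defpoly_but A alpha m H)%:F * (((linpoly (a H))%:F)^-1 * contract omega v)).
  apply: regular_atM => //; first exact: regular_at_tofrac.
  exists p, q; split; first by move/(divides_reduce B_adapted)/eqP; apply/negP.
  have qF : q%:F != 0.
    by rewrite tofrac_eq0; apply: contra_neq q0 => ->; rewrite reduce_polyE rmorph0.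
  by rewrite fE tofracM -[LHS]mulrA (divfK qF) (mulKf aH0).
(* Multiplying by alpha_H once already gives a polynomial, so a simple pole along H was the only one
   to exclude. *)
have := integral_regular_at (N := 1) (v := 1) aHprime reg.
rewrite tofrac1 !mulr1 expr1; apply.
rewrite [_^-1 * _]mulrC mulrA (divfK aH0) -defpoly_but_sub.
exact: Lint.
Qed.

End Exactness.

Theorem proposition1p1 (K : fieldType) (n : nat)
    (A : {fset {vspace 'rV[K]_n.+1}}) (m : multiplicity K n.+1)
    (alpha : formchoice K n.+1) (H : {vspace 'rV[K]_n.+1})
    (mstar : multiplicity K n.+1)
    (B : 'M[K]_n.+1) (alphaH : formchoice K n)
    (A_arr : is_arrangement A) (alpha_def : defining_forms A alpha)
    (H_in : H \in A) (m_H : (0 < m H)%N)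
    (mstar_euler : is_euler_multiplicity A m H mstar)
    (B_adapted : adapted_basis (alpha H) B)
    (alphaH_def : defining_forms (arr_in_coords B (restriction A H)) alphaH) :
  let Omega := log_form A alpha m in
  let Omega' := log_form A alpha (mult_sub m H) in
  let OmegaH := log_form (arr_in_coords B (restriction A H)) alphaH
                         (mult_in_coords B mstar) in
  let aH := (poly_of_form (alpha H))%:F in
  [/\ (* i_H^* is defined on Omega' and maps it into OmegaH *)
      forall omega, Omega' omega ->
        (forall j : 'I_n, no_pole_along_H B (coef_dy B omega (lift ord0 j)))
        /\ OmegaH (restrict_form B omega),
      (* multiplication by alpha_H maps Omega into Omega' *)
      forall omega, Omega omega -> Omega' (aH *: omega),
      (* exactness at Omega *)
      forall omega, Omega omega -> aH *: omega = 0 -> omega = 0 &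
      (* exactness at Omega' *)
      forall omega, Omega' omega ->
        (restrict_form B omega = 0
         <-> exists2 omega0, Omega omega0 & omega = aH *: omega0)].
Proof.
rewrite poly_of_formE => Omega Omega' OmegaH aH.
have aH0 : aH != 0 by apply: (form_fraction_neq0 A_arr alpha_def H_in).
split=> [omega omega_log|omega|omega _ /eqP|omega omega_log].
- split=> [j|].
    exact: (no_pole_coef_dy A_arr alpha_def H_in B_adapted omega_log).
  exact: (log_form_restrict A_arr alpha_def H_in m_H mstar_euler B_adapted).
- exact: (log_form_mul A_arr alpha_def H_in m_H).
- by rewrite scaler_eq0 (negPf aH0) => /eqP.
split=> [res0|[omega0 omega0_log ->]].
  exists (aH^-1 *: omega); last by rewrite scalerA divff // scale1r.
  exact: (log_form_div A_arr alpha_def H_in m_H B_adapted).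
exact: (restrict_form_mul A_arr alpha_def H_in B_adapted omega0_log).
Qed.
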